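(* Let $m,L,U$ be integers with $1\le L\le U\le m$, let $\gamma_1,\dots,\gamma_m$ and $Y$ be discrete random variables (features and target), and let $\rho^L,\rho^U$ be real constants such that $\rho^L\le \bigl(\sum_{i,j\in[m]}x_ix_j\bigr)^{-1}\le \rho^U$ for every $x\in\mathcal X$, where $\mathcal X=\{x\in\{0,1\}^m : L\le \sum_{i\in[m]}x_i\le U\}$. Then problem (mRMR-Pers) is a mixed-integer linear programming formulation of problem (mRMR-Frac). Moreover, $V_{\mathrm{pers}}\le V_{\mathrm{rmc}}$, where $V_{\mathrm{pers}}$ and $V_{\mathrm{rmc}}$ are the optimal objective values of the natural continuous relaxations of (mRMR-Pers) and (mRMR-Rmc), respectively. (All three problems are defined in the context.)
   Context: $[m]=\{1,\dots,m\}$. For discrete random variables $A,B$ with finite supports, joint probability mass function $p(a,b)$ and marginals $p(a),p(b)$, the mutual information is $\mathrm{MI}(A,B)=\sum_{a,b}p(a,b)\log\frac{p(a,b)}{p(a)p(b)}$. Write $c_{ij}=\mathrm{MI}(\gamma_i,Y)-\mathrm{MI}(\gamma_i,\gamma_j)$ for $i,j\in[m]$. (mRMR-Frac): maximize $$\frac{\sum_{i\in[m]}\sum_{j\in[m]}c_{ij}x_ix_j}{\sum_{i\in[m]}\sum_{j\in[m]}x_ix_j}$$ over $x\in\mathcal X=\{x\in\{0,1\}^m : L\le\sum_{i\in[m]}x_i\le U\}$. (mRMR-Pers): maximize $\sum_{i,j\in[m]}c_{ij}z_{ij}$ over $x\in\mathcal X$, $\rho\in\mathbb R$, $y\in\mathbb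 R^m$, $z\in\mathbb R^{m\times m}$ subject to - $\sum_{i,j\in[m]}z_{ij}=1$, and $z_{ii}=y_i$ for $i\in[m]$; - $0\le z_{ij}\le y_i$ and $y_i+y_j-\rho\le z_{ij}\le y_j$ for $i\in[m]$, $j\in[m]\setminus\{i\}$; - $x_k\le U^2y_k$, $x_k\le L^2y_k+1-L^2\rho$, $x_k\ge L^2y_k$, $x_k\ge U^2y_k+1-U^2\rho$ for $k\in[m]$. (mRMR-Rmc): maximize $\sum_{i,j\in[m]}c_{ij}z_{ij}$ over $x\in\mathcal X$, $\rho\in\mathbb R$, $y\in\mathbb R^m$, $z\in\mathbb R^{m\times m}$ subject to - $\sum_{i,j\in[m]}z_{ij}=1$, and $z_{ii}=y_i$ for $i\in[m]$; - $\max\{\rho^Lx_i,\ \rho^Ux_i+\rho-\rho^U\}\le y_i\le\min\{\rho^Lx_i+\rho-\rho^L,\ \rho^Ux_i\}$ for $i\in[m]$; - $\max\{0,\ \rho^Ux_j+y_i-\rho^U\}\le z_{ij}\le\min\{y_i,\ \rho^Ux_j\}$ for $i\in[m]$, $j\in[m]\setminus\{i\}$. The natural continuous relaxation of (mRMR-Pers) or (mRMR-Rmc) is obtained by dropping integrality, i.e. replacing $x\in\mathcal X$ by $x\in[0,1]^m$, $L\le\sum_{i\in[m]}x_i\le U$. ''(mRMR-Pers) is a mixed-integer linear programming formulation of (mRMR-Frac)'' means: (mRMR-Pers) has linear objective and linear constraints apart from $x\in\{0,1\}^m$; the set of $x$ that extend to a feasible point $(x,\rho,y,z)$ of (mRMR-Pers)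 is exactly $\mathcal X$; and for each $x\in\mathcal X$ the maximum of the objective of (mRMR-Pers) over such extensions equals the objective value of (mRMR-Frac) at $x$ (in particular the two problems have the same optimal value and the same optimal $x$). *)

(* Defs.v *)
(* MathComp / MathComp-Analysis. *)
From HB Require Import structures.
From mathcomp Require Import all_boot all_order all_algebra.
From mathcomp Require Import all_classical all_reals all_analysis.

Set Implicit Arguments.
Unset Strict Implicit.
Unset Printing Implicit Defensive.

Import Order.TTheory GRing.Theory Num.Theory.

Local Open Scope classical_set_scope.
Local Open Scope ring_scope.

Section mutual_information.
Context {d dA dB : measure_display} {T : measurableType d}
  {A : measurableType dA} {B : measurableType dB}
  {R : realType} {P : probability T R}.

(* The library's [pmf] is restricted to real-valued random variables. *)
Definition dpmf (X : {dRV P >-> A}) (a : A) : R := fine (P (X @^-1` [set a])).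

Definition joint_pmf (X : {dRV P >-> A}) (Y : {dRV P >-> B})
    (a : A) (b : B) : R :=
  fine (P (X @^-1` [set a] `&` Y @^-1` [set b])).

End mutual_information.

Definition dsupport {d dA : measure_display} {T : measurableType d}
    {A : measurableType dA} {R : realType} {P : probability T R}
    (X : {dRV P >-> A}) : set A :=
  [set a | dpmf X a != 0].

(* Natural logarithm.  A pair with joint mass 0 contributes 0, which is the
   usual convention 0 log 0 = 0.  The sums are meant for finite supports: a
   [\sum_(_ \in _)] with infinitely many nonzero terms is 0 by convention. *)
Definition mutual_info {d dA dB : measure_display} {T : measurableType d}
    {A : measurableType dA} {B : measurableType dB}
    {R : realType} {P : probability T R}
    (X : {dRV P >-> A}) (Y : {dRV P >-> B}) : R :=
  \sum_(a \in dsupport X) \sum_(b \in dsupport Y)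
    joint_pmf X Y a b * ln (joint_pmf X Y a b / (dpmf X a * dpmf Y b)).

Definition mrmr_coef {d dF : measure_display} {T : measurableType d}
    {R : realType} {P : probability T R} {m : nat}
    {dE : 'I_m -> measure_display} {E : forall i, measurableType (dE i)}
    {F : measurableType dF}
    (gamma : forall i, {dRV P >-> E i}) (Y : {dRV P >-> F})
    (i j : 'I_m) : R :=
  mutual_info (gamma i) Y - mutual_info (gamma i) (gamma j).

Section optimization.
Context {R : realType} {V : Type}.

(* -oo if [F] is empty and +oo if [g] is unbounded above on [F]. *)
Definition opt_value (F : set V) (g : V -> R) : \bar R :=
  ereal_sup [set (g v)%:E | v in F].

Definition is_maximum (F : set V) (g : V -> R) (M : R) : Prop :=
  (exists2 v, F v & g v = M) /\ (forall v, F v -> g v <= M).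

Definition argmax (F : set V) (g : V -> R) : set V :=
  [set v | F v /\ forall w, F w -> g w <= g v].

End optimization.

(* A finite system of affine inequalities; equations are pairs of these. *)
Definition linear_system {R : realType} {V : lmodType R} (S : set V) : Prop :=
  exists (I : finType) (a : I -> {linear V -> R^o}) (b : I -> R),
    S = [set v | forall i, (a i v : R) <= b i].

Section mrmr.
Context {R : realType} {m : nat}.

(* A point (x, rho, y, z); [R^o] makes this a vector space over [R]. *)
Definition decision : lmodType R :=
  ('rV[R]_m * R^o * 'rV[R]_m * 'M[R]_m)%type.

Definition x_part (v : decision) : 'rV[R]_m := v.1.1.1.
Definition rho_part (v : decision) : R := v.1.1.2.
Definition y_part (v : decision) : 'rV[R]_m := v.1.2.
Definition z_part (v : decision) : 'M[R]_m := v.2.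

Definition binary (x : 'rV[R]_m) : Prop :=
  forall i, x ord0 i = 0 \/ x ord0 i = 1.

Definition unit_box (x : 'rV[R]_m) : Prop :=
  forall i, 0 <= x ord0 i <= 1.

Definition cardinality_constraint (L U : nat) (x : 'rV[R]_m) : Prop :=
  L%:R <= \sum_i x ord0 i <= U%:R.

Definition feasible_selection (L U : nat) : set 'rV[R]_m :=
  [set x | binary x /\ cardinality_constraint L U x].

Definition pair_count (x : 'rV[R]_m) : R :=
  \sum_i \sum_j x ord0 i * x ord0 j.

Definition frac_objective (c : 'I_m -> 'I_m -> R) (x : 'rV[R]_m) : R :=
  (\sum_i \sum_j c i j * x ord0 i * x ord0 j) / pair_count x.

Definition lin_objective (c : 'I_m -> 'I_m -> R) (v : decision) : R :=
  \sum_i \sum_j c i j * z_part v i j.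

(* All constraints except those confining each x_i to {0,1} (or to [0,1] in
   the relaxation). *)
Definition pers_constraints (L U : nat) : set decision :=
  [set v | let x := x_part v ord0 in let rho := rho_part v in
           let y := y_part v ord0 in let z := z_part v in
    [/\ cardinality_constraint L U (x_part v),
        \sum_i \sum_j z i j = 1,
        forall i, z i i = y i,
        forall i j, j != i ->
          (0 <= z i j <= y i) /\ (y i + y j - rho <= z i j <= y j) &
        forall k,
          [/\ x k <= U%:R ^+ 2 * y k,
              x k <= L%:R ^+ 2 * y k + 1 - L%:R ^+ 2 * rho,
              x k >= L%:R ^+ 2 * y k &
              x k >= U%:R ^+ 2 * y k + 1 - U%:R ^+ 2 * rho]]].

Definition rmc_constraints (L U : nat) (rhoL rhoU : R) : set decision :=
  [set v | let x := x_part v ord0 in let rho := rho_part v in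
           let y := y_part v ord0 in let z := z_part v in
    [/\ cardinality_constraint L U (x_part v),
        \sum_i \sum_j z i j = 1,
        forall i, z i i = y i,
        forall i,
          Num.max (rhoL * x i) (rhoU * x i + rho - rhoU) <= y i
            <= Num.min (rhoL * x i + rho - rhoL) (rhoU * x i) &
        forall i j, j != i ->
          Num.max 0 (rhoU * x j + y i - rhoU) <= z i j
            <= Num.min (y i) (rhoU * x j)]].

Definition mixed_binary (C : set decision) : set decision :=
  [set v | binary (x_part v) /\ C v].

Definition continuous_relaxation (C : set decision) : set decision :=
  [set v | unit_box (x_part v) /\ C v].

(* Maximizing [g] over [mixed_binary C] is a mixed-integer linear programming
   formulation of maximizing [f] over [X].  The last two items are
   consequences of the preceding ones. *)
Definition milp_formulation (C : set decision) (g : decision -> R)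
    (X : set 'rV[R]_m) (f : 'rV[R]_m -> R) : Prop :=
  [/\ linear (g : decision -> R^o) /\ linear_system C,
      x_part @` mixed_binary C = X,
      forall x, X x ->
        is_maximum [set v | mixed_binary C v /\ x_part v = x] g (f x),
      opt_value (mixed_binary C) g = opt_value X f &
      x_part @` argmax (mixed_binary C) g = argmax X f].

End mrmr.

(* Main.v *)
Require Import Defs.
From HB Require Import structures.
From mathcomp Require Import all_boot all_order all_algebra.
From mathcomp Require Import all_classical all_reals all_analysis.
From mathcomp Require Import ring lra.

(** The four constraints linking [x_k], [y_k] and [rho] are a rescaled form of
    [x_k / U^2 <= y_k <= x_k / L^2] and
    [(1 - x_k) / U^2 <= rho - y_k <= (1 - x_k) / L^2]
    ([perspective_boundsP]): they are the McCormick envelope of the product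
    [y_k = rho x_k] for [rho] between [1 / U^2] and [1 / L^2].  Both halves of
    the theorem come from this reading.

    For binary [x] a McCormick envelope is exact, so [y_k = rho x_k]; the
    constraints on [z_ij] are again an envelope, now of [rho x_i x_j], and are
    exact as well.  Normalization of [z] then forces
    [rho = 1 / (sum_ij x_i x_j)].  Hence every selection extends to exactly one
    matrix [z], namely [x_i x_j / (sum_ij x_i x_j)], at which the linear
    objective is the fractional one ([pers_z_partE], [pers_lift_feasible]).

    For the relaxations, selections of sizes [L] and [U] exist, so any valid
    constants satisfy [rhoL <= 1 / U^2] and [1 / L^2 <= rhoU]: the envelope above
    is the tightest that valid constants allow.  Weakening the constants, and bounding [z_ij]
    through [y_j], turns every relaxed point of the perspective model into a
    relaxed point of the other model with the same objective
    ([pers_relaxation_sub_rmc]). *)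

Set Implicit Arguments.
Unset Strict Implicit.
Unset Printing Implicit Defensive.

Import Order.TTheory GRing.Theory Num.Theory.

Local Open Scope classical_set_scope.
Local Open Scope ring_scope.

(** * Affine functionals and linear systems *)

Section affine.
Context {R : realType} {V : lmodType R}.
Implicit Types (f g : V -> R) (S : set V).

(** Equivalent to linearity of [f - f 0]; in this form each closure property is
    a ring identity. *)
Definition affine f : Prop :=
  forall a u v, f (a *: u + v) = a * (f u - f 0) + f v.

Lemma affine_cst (k : R) : affine (fun=> k).
Proof. by move=> a u v; ring. Qed.

Lemma affineD f g : affine f -> affine g -> affine (fun v => f v + g v).
Proof. by move=> hf hg a u v; rewrite hf hg; ring. Qed.

Lemma affineN f : affine f -> affine (fun v => - f v).
Proof. by move=> hf a u v; rewrite hf; ring. Qed.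

Lemma affineZ (k : R) f : affine f -> affine (fun v => k * f v).
Proof. by move=> hf a u v; rewrite hf; ring. Qed.

Lemma affine_sum (I : finType) (f : I -> V -> R) :
  (forall i, affine (f i)) -> affine (fun v => \sum_i f i v).
Proof.
move=> hf a u v; under eq_bigr do rewrite hf.
by rewrite big_split /= -mulr_sumr sumrB.
Qed.

Lemma linear_affine f : linear (f : V -> R^o) -> affine f.
Proof.
move=> hf; have f0 : f 0 = 0.
  by have := hf 1 0 0; rewrite !scale1r addr0 => /eqP; rewrite -subr_eq0
    opprD addNKr oppr_eq0 => /eqP.
by move=> a u v; rewrite hf f0 subr0.
Qed.

Lemma linear_system_le f g :
  affine f -> affine g -> linear_system [set v | f v <= g v].
Proof.
move=> hf hg; pose h v : R^o := (f v - g v) - (f 0 - g 0).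
have h_lin : linear h.
  by move=> a u v; rewrite /h hf hg /GRing.scale /=; ring.
pose l : {linear V -> R^o} :=
  HB.pack h (GRing.isLinear.Build R V R^o *:%R h h_lin).
exists unit, (fun=> l), (fun=> g 0 - f 0).
rewrite predeqE => v /=; rewrite /h; split=> [hfg _|/(_ tt)]; lra.
Qed.

Lemma linear_systemI S1 S2 :
  linear_system S1 -> linear_system S2 -> linear_system (S1 `&` S2).
Proof.
move=> [I [a [b ->]]] [J [a' [b' ->]]].
exists (I + J)%type, (fun k => match k with inl i => a i | inr j => a' j end),
  (fun k => match k with inl i => b i | inr j => b' j end).
rewrite predeqE => v; split=> [[h1 h2] [i|j]|h] //=.
by split=> i; [exact: (h (inl i))|exact: (h (inr i))].
Qed.

Lemma linear_system_eq f g :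
  affine f -> affine g -> linear_system [set v | f v = g v].
Proof.
move=> hf hg.
have -> : [set v | f v = g v] =
    [set v | f v <= g v] `&` [set v | g v <= f v].
  rewrite predeqE => v; split=> [/= ->|[/= fg gf]] //.
  by apply/eqP; rewrite eq_le fg.
by apply: linear_systemI; apply: linear_system_le.
Qed.

Lemma linear_system_forall (K : finType) (S : K -> set V) :
  (forall k, linear_system (S k)) -> linear_system [set v | forall k, S k v].
Proof.
move=> hS; pose I k := sval (cid (hS k)); pose hI k := cid (svalP (cid (hS k))).
pose a k := sval (hI k); pose ha k := cid (svalP (hI k)); pose b k := sval (ha k).
have SE k : S k = [set v | forall i, (a k i v : R) <= b k i].
  exact: svalP (ha k).
exists {k : K & I k}, (fun p => a (tag p) (tagged p)),
  (fun p => b (tag p) (tagged p)).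
rewrite predeqE => v; split=> [h [k i]|h k] /=.
  by move: (h k); rewrite SE; apply.
by rewrite SE => i; exact: (h (Tagged I i)).
Qed.

Lemma linear_system_imply (p : bool) S :
  linear_system S -> linear_system [set v | p -> S v].
Proof.
case: p => hS.
  by rewrite (_ : [set v | _] = S) // predeqE => v /=; split=> [/(_ isT)|].
exists void, (of_void _), (of_void _).
by rewrite predeqE => v; split=> // _ [].
Qed.

End affine.

Section pers.
Context {R : realType} {m : nat}.
Implicit Types (x : 'rV[R]_m) (v : @decision R m) (c : 'I_m -> 'I_m -> R).

Lemma affine_x_part i : affine (fun v => x_part v ord0 i).
Proof. by apply: linear_affine => a u v; rewrite /x_part /= !mxE. Qed.

Lemma affine_rho_part : affine (fun v => rho_part v).
Proof. exact: linear_affine. Qed.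

Lemma affine_y_part i : affine (fun v => y_part v ord0 i).
Proof. by apply: linear_affine => a u v; rewrite /y_part /= !mxE. Qed.

Lemma affine_z_part i j : affine (fun v => z_part v i j).
Proof. by apply: linear_affine => a u v; rewrite /z_part /= !mxE. Qed.

Lemma linear_lin_objective c : linear (lin_objective c : decision -> R^o).
Proof.
move=> a u v; rewrite /lin_objective /GRing.scale /= mulr_sumr -big_split /=.
apply: eq_bigr => i _; rewrite mulr_sumr -big_split /=; apply: eq_bigr => j _.
by rewrite /z_part /= !mxE; ring.
Qed.

Lemma linear_system_pers (L U : nat) :
  linear_system (@pers_constraints R m L U).
Proof.
pose D := @decision R m.
pose S1 := [set v : D | L%:R <= \sum_i x_part v ord0 i].
pose S2 := [set v : D | \sum_i x_part v ord0 i <= U%:R].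
pose S3 := [set v : D | \sum_i \sum_j z_part v i j = 1].
pose S4 := [set v : D | forall i, z_part v i i = y_part v ord0 i].
pose T i j := [set v : D | 0 <= z_part v i j]
  `&` [set v | z_part v i j <= y_part v ord0 i]
  `&` [set v | y_part v ord0 i + y_part v ord0 j - rho_part v <= z_part v i j]
  `&` [set v | z_part v i j <= y_part v ord0 j].
pose S5 := [set v : D | forall i j, j != i -> T i j v].
pose W k := [set v : D | x_part v ord0 k <= U%:R ^+ 2 * y_part v ord0 k]
  `&` [set v | x_part v ord0 k
               <= L%:R ^+ 2 * y_part v ord0 k + 1 - L%:R ^+ 2 * rho_part v]
  `&` [set v | L%:R ^+ 2 * y_part v ord0 k <= x_part v ord0 k]
  `&` [set v | U%:R ^+ 2 * y_part v ord0 k + 1 - U%:R ^+ 2 * rho_part v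
               <= x_part v ord0 k].
pose S6 := [set v : D | forall k, W k v].
have -> : @pers_constraints R m L U = S1 `&` S2 `&` S3 `&` S4 `&` S5 `&` S6.
  rewrite predeqE => v; split.
    move=> [/andP[h1 h2] h3 h4 h5 h6]; split; last first.
      by move=> k; have [] := h6 k.
    split=> // i j ij.
    by have [/andP[? ?] /andP[? ?]] := h5 i j ij.
  move=> [[[[[h1 h2] h3] h4] h5] h6]; split => //; first exact/andP.
    by move=> i j ij; have [[[? ?] ?] ?] := h5 i j ij; split; exact/andP.
  by move=> k; have [[[? ?] ?] ?] := h6 k.
have affB (f g : D -> R) :
    affine f -> affine g -> affine (fun v => f v - g v).
  by move=> hf hg; apply: affineD => //; exact: affineN.
have affx := affine_x_part; have affy := affine_y_part.
have affz := affine_z_part; have affr := affine_rho_part.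
repeat apply: linear_systemI.
- apply: linear_system_le; first exact: affine_cst.
  exact: affine_sum.
- apply: linear_system_le; last exact: affine_cst.
  exact: affine_sum.
- apply: linear_system_eq; last exact: affine_cst.
  by apply: affine_sum => i; exact: affine_sum.
- by apply: linear_system_forall => i; exact: linear_system_eq.
- apply: linear_system_forall => i; apply: linear_system_forall => j.
  apply: linear_system_imply; repeat apply: linear_systemI;
    apply: linear_system_le => //; first exact: affine_cst.
  by apply: affB => //; exact: affineD.
- apply: linear_system_forall => k; repeat apply: linear_systemI;
    apply: linear_system_le => //; try exact: affineZ.
  + apply: affB; last exact: affineZ.
    by apply: affineD; [exact: affineZ|exact: affine_cst].
  + apply: affB; last exact: affineZ.
    by apply: affineD; [exact: affineZ|exact: affine_cst].
Qed.

(** * Exactness at binary points *)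

(** Dividing by [L^2] and [U^2] exhibits the constraints as the McCormick
    envelope of [y = rho * x]: the product [rho * x] is bounded through
    [rho in [1/U^2, 1/L^2]], and so is [rho * (1 - x)], written [rho - y]. *)
Lemma perspective_boundsP (L U : nat) (x y rho : R) : (0 < L)%N -> (0 < U)%N ->
  [/\ x <= U%:R ^+ 2 * y, x <= L%:R ^+ 2 * y + 1 - L%:R ^+ 2 * rho,
      x >= L%:R ^+ 2 * y & x >= U%:R ^+ 2 * y + 1 - U%:R ^+ 2 * rho] <->
  (x / U%:R ^+ 2 <= y <= x / L%:R ^+ 2) /\
  ((1 - x) / U%:R ^+ 2 <= rho - y <= (1 - x) / L%:R ^+ 2).
Proof.
move=> L0 U0.
have l0 : 0 < L%:R ^+ 2 :> R by rewrite exprn_gt0 // ltr0n.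
have u0 : 0 < U%:R ^+ 2 :> R by rewrite exprn_gt0 // ltr0n.
rewrite !ler_pdivrMr // !ler_pdivlMr //; split.
  by move=> [h1 h2 h3 h4]; split; apply/andP; split; lra.
by move=> [/andP[h1 h3] /andP[h4 h2]]; split; lra.
Qed.

Lemma pair_countE x : pair_count x = (\sum_i x ord0 i) ^+ 2.
Proof. by rewrite expr2 big_distrlr. Qed.

Lemma pair_count_bounds (L U : nat) x : cardinality_constraint L U x ->
  L%:R ^+ 2 <= pair_count x <= U%:R ^+ 2.
Proof.
move=> /andP[Ls sU]; have s0 := le_trans (ler0n R L) Ls.
by rewrite pair_countE !lerXn2r ?nnegrE ?ler0n.
Qed.

(** Each envelope collapses when one factor is binary, first giving
    [y = rho * x] and then [z_ij = rho * x_i * x_j]; the normalization of [z]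
    determines [rho]. *)
Lemma pers_z_partE (L U : nat) v : (0 < L)%N -> (0 < U)%N ->
  mixed_binary (pers_constraints L U) v ->
  forall i j, z_part v i j
    = x_part v ord0 i * x_part v ord0 j / pair_count (x_part v).
Proof.
move=> L0 U0 [bx [_ sum_z zii zij hy]].
have yE k : y_part v ord0 k = rho_part v * x_part v ord0 k.
  have /perspective_boundsP := hy k; move=> /(_ L0 U0)[/andP[h1 h2] /andP[h3 h4]].
  have [xk|xk] := bx k; rewrite xk in h1 h2 h3 h4 *.
    by rewrite !mul0r in h1 h2; lra.
  by rewrite subrr !mul0r in h3 h4; lra.
have zE i j : z_part v i j = rho_part v * (x_part v ord0 i * x_part v ord0 j).
  have [->|ij] := eqVneq j i.
    by rewrite zii yE; case: (bx i) => ->; ring.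
  have [/andP[h1 h2] /andP[h3 h4]] := zij i j ij.
  rewrite !yE in h2 h3 h4.
  by case: (bx i) => xi; case: (bx j) => xj; rewrite xi xj in h2 h3 h4 *; lra.
have rho_pc : rho_part v * pair_count (x_part v) = 1.
  rewrite -sum_z mulr_sumr; apply: eq_bigr => i _.
  by rewrite mulr_sumr; apply: eq_bigr => j _; rewrite zE.
have pc0 : pair_count (x_part v) != 0.
  by apply: contra_eq_neq rho_pc => ->; rewrite mulr0 eq_sym oner_eq0.
by move=> i j; rewrite zE -[rho_part v](mulfK pc0) rho_pc; ring.
Qed.

Lemma pers_objectiveE (L U : nat) c v : (0 < L)%N -> (0 < U)%N ->
  mixed_binary (pers_constraints L U) v ->
  lin_objective c v = frac_objective c (x_part v).
Proof.
move=> L0 U0 hv; rewrite /lin_objective /frac_objective mulr_suml.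
apply: eq_bigr => i _; rewrite mulr_suml; apply: eq_bigr => j _.
by rewrite (pers_z_partE L0 U0 hv) !mulrA.
Qed.

Definition pers_lift x : decision :=
  let rho := (pair_count x)^-1 in
  (x, rho, rho *: x, \matrix_(i, j) (rho * (x ord0 i * x ord0 j))).

Lemma pers_lift_feasible (L U : nat) x : (0 < L)%N -> (0 < U)%N ->
  feasible_selection L U x ->
  mixed_binary (pers_constraints L U) (pers_lift x).
Proof.
move=> L0 U0 [bx cx]; split=> //.
have l0 : 0 < L%:R ^+ 2 :> R by rewrite exprn_gt0 // ltr0n.
have u0 : 0 < U%:R ^+ 2 :> R by rewrite exprn_gt0 // ltr0n.
have /andP[Lp pU] := pair_count_bounds cx.
have p0 : 0 < pair_count x := lt_le_trans l0 Lp.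
have rL : (pair_count x)^-1 <= (L%:R ^+ 2)^-1 by rewrite lef_pV2.
have rU : (U%:R ^+ 2)^-1 <= (pair_count x)^-1 by rewrite lef_pV2.
have r0 : 0 < (pair_count x)^-1 by rewrite invr_gt0.
have pK : (pair_count x)^-1 * pair_count x = 1 by rewrite mulVf // gt_eqF.
rewrite /pers_lift; split; rewrite /x_part /rho_part /y_part /z_part //=.
- rewrite -[RHS]pK mulr_sumr; apply: eq_bigr => i _.
  by rewrite mulr_sumr; apply: eq_bigr => j _; rewrite mxE.
- by move=> i; rewrite !mxE; case: (bx i) => ->; ring.
- move=> i j _; rewrite !mxE.
  by case: (bx i) => ->; case: (bx j) => ->; split; apply/andP; split; lra.
- move=> k; apply/perspective_boundsP => //; rewrite !mxE.
  by case: (bx k) => ->; split; apply/andP; split; lra.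
Qed.

End pers.

(** Since [g] is constant, equal to [f x], on the feasible points above each [x],
    every optimization notion for [g] is the pullback along [x_part] of the one
    for [f]. *)
Lemma milp_formulationI {R : realType} {m : nat} (C : set (@decision R m))
    (g : decision -> R) (X : set 'rV[R]_m) (f : 'rV[R]_m -> R) :
  linear (g : decision -> R^o) -> linear_system C ->
  x_part @` mixed_binary C = X ->
  (forall v, mixed_binary C v -> g v = f (x_part v)) ->
  milp_formulation C g X f.
Proof.
move=> glin Csys proj gE; split=> //.
- move=> x; rewrite -proj => -[v Cv <-]; split.
    by exists v => //; exact: gE.
  by move=> w [Cw <-]; rewrite gE.
- congr ereal_sup; rewrite -proj predeqE => e; split.
    move=> [v Cv <-]; rewrite gE //.
    by exists (x_part v) => //; exists v.
  by move=> [_ [v Cv <-] <-]; exists v => //; rewrite gE.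
- rewrite predeqE => x; split.
    move=> [v [Cv vmax] <-]; split; first by rewrite -proj; exists v.
    by move=> w; rewrite -proj => -[u Cu <-]; rewrite -!gE //; exact: vmax.
  move=> [+ xmax]; rewrite -proj => -[v Cv vx]; exists v => //; split=> // w Cw.
  by rewrite !gE // vx; apply: xmax; rewrite -proj; exists w.
Qed.

(** * Comparison of the relaxations *)

Section relaxation.
Context {R : realType} {m : nat}.

Lemma feasible_selection_card (L U k : nat) : (L <= k <= U)%N -> (k <= m)%N ->
  exists2 x : 'rV[R]_m, feasible_selection L U x & pair_count x = k%:R ^+ 2.
Proof.
move=> /andP[Lk kU] km; pose x : 'rV[R]_m := \row_i (i < k)%:R.
have sx : \sum_i x ord0 i = k%:R.
  under eq_bigr do rewrite mxE.
  rewrite -natr_sum; congr _%:R.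
  rewrite -[RHS]card_ord -sum1_card (big_ord_widen m (fun=> 1%N)) // [RHS]big_mkcond.
  by apply: eq_bigr => i _; case: ltnP.
exists x; last by rewrite pair_countE sx.
split; first by move=> i; rewrite mxE; case: (_ < _)%N; [right|left].
by rewrite /cardinality_constraint sx !ler_nat Lk kU.
Qed.

(** The McCormick bounds with constants [1/U^2] and [1/L^2] imply those with any
    weaker [rhoL] and [rhoU] because [x] and [1 - x] are nonnegative.  The upper
    bounds on [y_j] and on [rho - y_j] turn [z_ij <= y_j] and
    [y_i + y_j - rho <= z_ij] into the bounds that use [x_j] directly. *)
Lemma pers_relaxation_sub_rmc (L U : nat) (rhoL rhoU : R) :
  (0 < L)%N -> (0 < U)%N -> rhoL <= (U%:R ^+ 2)^-1 -> (L%:R ^+ 2)^-1 <= rhoU ->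
  continuous_relaxation (@pers_constraints R m L U)
  `<=` continuous_relaxation (rmc_constraints L U rhoL rhoU).
Proof.
move=> L0 U0 hrL hrU v [box [card sum_z zii zij hy]]; split=> //.
have bnd k : (rhoL * x_part v ord0 k <= y_part v ord0 k
                <= rhoU * x_part v ord0 k) /\
    (rhoL * (1 - x_part v ord0 k) <= rho_part v - y_part v ord0 k
       <= rhoU * (1 - x_part v ord0 k)).
  have /perspective_boundsP := hy k; move=> /(_ L0 U0)[/andP[h1 h2] /andP[h3 h4]].
  have /andP[x0 x1] := box k; rewrite -subr_ge0 in x1.
  have mL := ler_wpM2r x0 hrL; have mU := ler_wpM2r x0 hrU.
  have mL' := ler_wpM2r x1 hrL; have mU' := ler_wpM2r x1 hrU.
  by split; apply/andP; split; lra.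
split=> //.
- move=> i; have [/andP[h1 h2] /andP[h3 h4]] := bnd i.
  by rewrite ge_max le_min; apply/andP; split; apply/andP; split; lra.
- move=> i j ij; have [/andP[h1 h2] /andP[h3 h4]] := zij i j ij.
  have [/andP[_ k2] /andP[_ k4]] := bnd j.
  by rewrite ge_max le_min; apply/andP; split; apply/andP; split; lra.
Qed.

End relaxation.

Theorem theorem1 (R : realType) (d : measure_display) (T : measurableType d)
    (P : probability T R) (m L U : nat)
    (hL : (1 <= L)%N) (hLU : (L <= U)%N) (hUm : (U <= m)%N)
    (dE : 'I_m -> measure_display) (E : forall i : 'I_m, measurableType (dE i))
    (hE : forall (i : 'I_m) (e : E i), measurable [set e])
    (dF : measure_display) (F : measurableType dF)
    (hF : forall e : F, measurable [set e])
    (gamma : forall i : 'I_m, {dRV P >-> E i}) (Y : {dRV P >-> F})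
    (hgamma : forall i : 'I_m, finite_set (dsupport (gamma i)))
    (hY : finite_set (dsupport Y))
    (rhoL rhoU : R)
    (hrho : forall x : 'rV[R]_m, feasible_selection L U x ->
      rhoL <= (pair_count x)^-1 <= rhoU) :
  milp_formulation (pers_constraints L U) (lin_objective (mrmr_coef gamma Y))
    (feasible_selection L U) (frac_objective (mrmr_coef gamma Y))
  /\ (opt_value (continuous_relaxation (pers_constraints L U))
        (lin_objective (mrmr_coef gamma Y))
      <= opt_value (continuous_relaxation (rmc_constraints L U rhoL rhoU))
        (lin_objective (mrmr_coef gamma Y)))%E.
Proof.
have L0 : (0 < L)%N by [].
have U0 : (0 < U)%N := leq_trans hL hLU.
split.
  apply: milp_formulationI; first exact: linear_lin_objective.
  - exact: linear_system_pers.
  - rewrite predeqE => x; split=> [[v [bv [cv _ _ _ _]] <-]|hx]; first by split.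
    by exists (pers_lift x); [exact: pers_lift_feasible|].
  - by move=> v; exact: pers_objectiveE.
apply/le_ereal_sup/image_subset; apply: pers_relaxation_sub_rmc => //.
- have [x /hrho/andP[h _] <-//] :=
    @feasible_selection_card R m L U U (introT andP (conj hLU (leqnn U))) hUm.
- have [x /hrho/andP[_ h] <-//] := @feasible_selection_card R m L U L
    (introT andP (conj (leqnn L) hLU)) (leq_trans hLU hUm).
Qed.
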